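(* There is a polynomial-time $2$-approximation algorithm for the Pure Fixed Charge Transportation problem with Sink-Independent Fixed Costs (PFCT-S): given any PFCT-S instance, it outputs a feasible solution $x\in\mathcal{X}$ whose cost is at most $2$ times the optimum cost of the instance.
   Context: Fixed Charge Transportation (FCT): we are given a set $S$ of $n$ sources and a set $T$ of $m$ sinks; each source $i$ has supply $a_i\in\mathbb{Z}_{>0}$, each sink $j$ has demand $b_j\in\mathbb{Z}_{>0}$, with $\sum_{i\in S}a_i=\sum_{j\in T}b_j$; every pair $(i,j)\in S\times T$ has a fixed cost $f_{ij}\ge 0$ and a linear cost ratio $c_{ij}\ge 0$. The feasible set is $\mathcal{X}=\{x\in\mathbb{R}_{\ge0}^{S\times T}:\sum_{j\in T}x_{ij}=a_i\ \forall i\in S,\ \sum_{i\in S}x_{ij}=b_j\ \forall j\in T\}$, and the cost of $x\in\mathcal{X}$ is $\sum_{i\in S,j\in T}(\mathbf{1}_{x_{ij}>0}f_{ij}+c_{ij}x_{ij})$; the goal is to minimize the cost. PFCT is the special case $c_{ij}=0$ for all $i,j$. PFCT-S is the special case of PFCT where there is a vector $(f_i)_{i\in S}\in\mathbb{R}_{\ge0}^S$ with $f_{ij}=f_i$ for all $i\in S,j\in T$. *)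

(* Defs.v *)
From HB Require Import structures.
From mathcomp Require Import all_boot all_order all_algebra.
From mathcomp Require Import boolp classical_sets reals.

Set Implicit Arguments.
Unset Strict Implicit.
Unset Printing Implicit Defensive.

Import Order.TTheory GRing.Theory Num.Theory.
Local Open Scope ring_scope.
Local Open Scope classical_set_scope.

Record FCT (R : realType) := MkFCT {
  nsrc : nat;
  nsnk : nat;
  supply : 'I_nsrc -> nat;
  demand : 'I_nsnk -> nat;
  fixc : 'I_nsrc -> 'I_nsnk -> R;
  linc : 'I_nsrc -> 'I_nsnk -> R;
  supply_gt0 : forall i, (0 < supply i)%N;
  demand_gt0 : forall j, (0 < demand j)%N;
  balanced : (\sum_i supply i)%N = (\sum_j demand j)%N;
  fixc_ge0 : forall i j, 0 <= fixc i j;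
  linc_ge0 : forall i j, 0 <= linc i j
}.

Section Problem.
Variables (R : realType) (I : FCT R).

Definition feasible : set 'M[R]_(nsrc I, nsnk I) :=
  [set x | [/\ forall i j, 0 <= x i j,
               forall i, \sum_j x i j = (supply i)%:R
             & forall j, \sum_i x i j = (demand j)%:R]].

Definition cost (x : 'M[R]_(nsrc I, nsnk I)) : R :=
  \sum_i \sum_j ((if 0 < x i j then fixc i j else 0) + linc i j * x i j).

Definition opt : R := inf [set cost x | x in feasible].

Definition PFCT : Prop := forall i j, linc (f := I) i j = 0.

(* [I] is a PFCT-S instance, witnessed by the vector [f]. *)
Definition PFCTS (f : 'I_(nsrc I) -> R) : Prop :=
  [/\ PFCT, forall i, 0 <= f i & forall i j, fixc i j = f i].

End Problem.

Arguments feasible {R} I _.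
Arguments cost {R} I x.
Arguments PFCTS {R} I f.

(* The random access machine of Cook and Reckhow (Time bounded random access
   machines, 1973) with logarithmic cost, extended by a multiplication also
   charged logarithmically, as in Aho, Hopcroft and Ullman. Polynomial time on
   it coincides with polynomial time on Turing machines. Registers X_0, X_1, ...
   hold integers, initially 0. *)
Inductive instr :=
| IConst of nat & int          (* IConst i z  : X_i <- z             *)
| IAdd of nat & nat & nat      (* IAdd i j k  : X_i <- X_j + X_k     *)
| ISub of nat & nat & nat      (* ISub i j k  : X_i <- X_j - X_k     *)
| IMul of nat & nat & nat      (* IMul i j k  : X_i <- X_j * X_k     *)
| IFetch of nat & nat          (* IFetch i j  : X_i <- X_(X_j)       *)
| IStore of nat & nat          (* IStore i j  : X_(X_i) <- X_j       *)
| IJpos of nat & nat           (* IJpos i l   : if X_i > 0, go to l  *)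
| IRead of nat                 (* IRead i     : X_i <- next input    *)
| IPrint of nat.               (* IPrint i    : output X_i           *)

Definition program := seq instr.

Record config := Config {
  pc : nat;
  reg : nat -> int;
  input : seq int;
  output : seq int
}.

Definition init (w : seq int) : config := Config 0 (fun=> 0) w [::].

Definition upd (r : nat -> int) (i : nat) (z : int) : nat -> int :=
  fun k => if k == i then z else r k.

(* [None] on a negative address or on reading past the end of the input: the *)
(* machine is stuck, which is not halting.                                   *)
Definition exec_instr (ins : instr) (c : config) : option config :=
  let: Config p r w o := c in
  match ins with
  | IConst i z => Some (Config p.+1 (upd r i z) w o)
  | IAdd i j k => Some (Config p.+1 (upd r i (r j + r k)) w o)
  | ISub i j k => Some (Config p.+1 (upd r i (r j - r k)) w o)
  | IMul i j k => Some (Config p.+1 (upd r i (r j * r k)) w o)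
  | IFetch i j =>
      if r j is Posz a then Some (Config p.+1 (upd r i (r a)) w o) else None
  | IStore i j =>
      if r i is Posz a then Some (Config p.+1 (upd r a (r j)) w o) else None
  | IJpos i l => Some (Config (if 0 < r i then l else p.+1) r w o)
  | IRead i =>
      if w is z :: w' then Some (Config p.+1 (upd r i z) w' o) else None
  | IPrint i => Some (Config p.+1 r w (rcons o (r i)))
  end.

(* Cook and Reckhow's l(z): 1 if z = 0, floor (log2 |z|) + 1 otherwise; recall *)
(* that trunc_log 2 0 = 0.                                                     *)
Definition bitlen (z : int) : nat := (trunc_log 2 `|z|%N).+1.

Definition instr_cost (ins : instr) (c : config) : nat :=
  let: Config _ r w _ := c in
  match ins with
  | IConst _ _ => 1
  | IAdd _ j k | ISub _ j k | IMul _ j k => bitlen (r j) + bitlen (r k)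
  | IFetch _ j => bitlen (r j) + bitlen (r `|r j|%N)
  | IStore i j => bitlen (r i) + bitlen (r j)
  | IJpos i _ => bitlen (r i)
  | IRead _ => bitlen (head 0%R w)
  | IPrint i => bitlen (r i)
  end%N.

(* [halts_in P c t c']: from [c], [P] halts in [c'] with total cost [t]. The *)
(* machine halts exactly when the program counter leaves the program.        *)
Inductive halts_in (P : program) : config -> nat -> config -> Prop :=
| HaltsNow c : (size P <= pc c)%N -> halts_in P c 0%N c
| HaltsStep c c1 c2 ins t :
    onth P (pc c) = Some ins -> exec_instr ins c = Some c1 ->
    halts_in P c1 t c2 -> halts_in P c (instr_cost ins c + t)%N c2.

Definition computes_in (P : program) (w : seq int) (t : nat) (o : seq int) :=
  exists2 c, halts_in P (init w) t c & output c = o.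

Definition word_size (w : seq int) : nat := (\sum_(z <- w) bitlen z)%N.

Definition encode_rat (q : rat) : seq int := [:: numq q; denq q].

(* n, m, a_1 .. a_n, b_1 .. b_m, and the fractions f_1 .. f_n in lowest terms *)
Definition encode_instance (R : realType) (I : FCT R)
    (f : 'I_(nsrc I) -> rat) : seq int :=
  [:: (nsrc I)%:Z; (nsnk I)%:Z]
    ++ [seq (supply i)%:Z | i : 'I_(nsrc I)]
    ++ [seq (demand j)%:Z | j : 'I_(nsnk I)]
    ++ flatten [seq encode_rat (f i) | i : 'I_(nsrc I)].

Arguments encode_instance {R} I f.

(* all entries, row by row *)
Definition encode_solution (n m : nat) (x : 'M[rat]_(n, m)) : seq int :=
  flatten [seq flatten [seq encode_rat (x i j) | j : 'I_m] | i : 'I_n].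

(* Main.v *)
(* Order the sources by decreasing fixed cost and the sinks by decreasing demand,
   lay the supplies and the demands end to end along [0, sum a) in these orders,
   and let x_ij be the length of the overlap of interval i with interval j. Every
   overlap starts at the left end of a source interval or of a sink interval, so
   the sources of fixed cost at least c, forming a set S, use at most #|S| + M
   pairs, where M sinks start before the total supply of S. Any feasible solution
   uses at least #|S| pairs there, and at least M because the largest demands come
   first. Hence the number of pairs is at most doubled above every threshold c,
   and Abel summation over c turns this into the bound on the cost. Each endpoint
   is a sum over the elements that come before, so no sorting is needed and the
   machine just runs nested loops. *)
Require Import Defs.
From HB Require Import structures.
From mathcomp Require Import all_boot all_order all_algebra.
From mathcomp Require Import boolp classical_sets reals.
From mathcomp Require Import zify.

Set Implicit Arguments.
Unset Strict Implicit.
Unset Printing Implicit Defensive.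

Import Order.TTheory GRing.Theory Num.Theory.
Local Open Scope ring_scope.

(** * Interval overlaps *)

(** Larger keys come first; ties go to the smaller index, which makes the order strict and total. *)
Definition precedes (d : Order.disp_t) (K : orderType d) (n : nat)
    (key : 'I_n -> K) : rel 'I_n :=
  fun k i => (key i < key k)%O || (key k == key i) && (k < i)%N.

Section Precedes.
Variables (d : Order.disp_t) (K : orderType d) (n : nat) (key : 'I_n -> K).
Local Notation prec := (precedes key).

Lemma precedes_irr i : prec i i = false.
Proof. by rewrite /precedes ltxx ltnn andbF. Qed.

Lemma precedes_trans : transitive prec.
Proof.
move=> j i k /orP[ij|/andP[/eqP ij lij]] /orP[jk|/andP[/eqP jk ljk]].
- by rewrite /precedes (lt_trans jk ij).
- by rewrite /precedes -jk ij.
- by rewrite /precedes ij jk.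
- by rewrite /precedes ij jk eqxx (ltn_trans lij ljk) orbT.
Qed.

Lemma precedes_total i k : i != k -> prec i k || prec k i.
Proof.
rewrite /precedes -val_eqE neq_ltn eq_sym.
by case: ltgtP => //= _; case: ltngtP; rewrite ?orbT.
Qed.

Lemma precedes_key i k : prec i k -> (key k <= key i)%O.
Proof. by case/orP=> [/ltW//|/andP[/eqP-> _]]. Qed.

Variable w : 'I_n -> nat.

Definition lo i := (\sum_(k | prec k i) w k)%N.
Definition hi i := (lo i + w i)%N.

(** The integer [u] stands for the unit segment from [u] to [u + 1]; endpoints are integers, so
    lengths become counts of such segments. *)
Definition meets (u : nat) (i : 'I_n) := (lo i <= u < hi i)%N.

Lemma sub_sum_nat (A B : {pred 'I_n}) : {subset A <= B} ->
  (\sum_(k in A) w k <= \sum_(k in B) w k)%N.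
Proof.
move=> AB; rewrite [leqRHS](bigID (mem A)) /= (_ : (\sum_(i | _ && _) _ = \sum_(k in A) w k)%N).
  exact: leq_addr.
by apply: eq_bigl => i; rewrite andb_idl //; apply: AB.
Qed.

Lemma hiE i : hi i = (\sum_(k | (k == i) || prec k i) w k)%N.
Proof.
rewrite (bigD1 i) ?eqxx //= /hi addnC; congr addn.
apply: eq_bigl => k; case: eqP => [->|_]; rewrite ?precedes_irr ?andbT //.
Qed.

Lemma hi_le_lo i k : prec i k -> (hi i <= lo k)%N.
Proof.
move=> ik; rewrite hiE; apply: sub_sum_nat => l.
rewrite !unfold_in => /orP[/eqP->//|li]; exact: precedes_trans li ik.
Qed.

Lemma hi_le_sum i (S : {pred 'I_n}) : i \in S -> (forall k, prec k i -> k \in S) ->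
  (hi i <= \sum_(k in S) w k)%N.
Proof.
move=> iS dS; rewrite hiE; apply: sub_sum_nat => l.
by rewrite !unfold_in => /orP[/eqP->//|/dS].
Qed.

Lemma hi_le_total i : (hi i <= \sum_k w k)%N.
Proof. exact: (@hi_le_sum i predT). Qed.

Lemma meets_inj u i k : meets u i -> meets u k -> i = k.
Proof.
move=> /andP[a b] /andP[c d']; apply: contraTeq isT => /precedes_total.
by case/orP=> /hi_le_lo; lia.
Qed.

Lemma sum_itv l h N :
  (\sum_(u < N) (l <= u < h)%N = minn h N - l)%N.
Proof.
elim: N => [|N IH]; first by rewrite big_ord0 minn0.
by rewrite big_ord_recr /= IH; lia.
Qed.

(** Disjointness makes each count at most 1; the lengths add up to the number of segments, so no
    count can be 0. *)
Lemma sum_meets u : (u < \sum_k w k)%N -> (\sum_i meets u i = 1)%N.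
Proof.
have le1 v : (\sum_i meets v i <= 1)%N.
  case: (pickP (meets v)) => [i vi|nv]; last by rewrite big1 // => i _; rewrite nv.
  rewrite (bigD1 i) //= vi big1 // => k ki; apply/eqP; rewrite eqb0.
  by apply: contra ki => vk; rewrite (meets_inj vi vk).
set N := (\sum_k w k)%N => uN; apply/eqP; rewrite eqn_leq le1 /=.
have: (\sum_(v < N) \sum_i meets v i = N)%N.
  rewrite exchange_big /=; apply: eq_bigr => i _; rewrite sum_itv.
  have := hi_le_total i; rewrite /hi -/N; lia.
rewrite (bigD1 (Ordinal uN)) //= => e.
have : (\sum_(v < N | v != Ordinal uN) \sum_i meets v i <= N.-1)%N.
  rewrite -[leqRHS](_ : #|predC1 (Ordinal uN)| = _)%N; last first.
    by rewrite cardC1 card_ord.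
  by rewrite -sum1_card; apply: leq_sum.
rewrite lt0n => h; apply/eqP => s0; move: e h; rewrite s0 add0n => ->; lia.
Qed.

End Precedes.

(* The elements before [j] have the largest total among sets of that size. *)
Lemma card_lo_lt n (b : 'I_n -> nat) (J : {set 'I_n}) (A : nat) :
  (A <= \sum_(j in J) b j)%N -> (#|[pred j | lo b b j < A]| <= #|J|)%N.
Proof.
move=> AJ; set T := [pred j | _].
case: (pickP T) => [j0 Tj0|T0]; last by rewrite (eq_card0 T0).
pose rank j := #|[pred k | precedes b k j]|.
(* [t] is the last element of [T] in the order, so [T] lies within [t] and its predecessors. *)
have [t Tt tmax] := @arg_maxnP _ j0 T rank Tj0.
have sTt k : T k -> k != t -> precedes b k t.
  move=> Tk kt; case/orP: (precedes_total b kt) => // tk.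
  have : (rank t < rank k)%N; last by rewrite ltnNge (tmax k Tk : rank k <= rank t)%N.
  apply: proper_card; apply/properP; split.
    by apply/fintype.subsetP => l; rewrite !inE => lt; apply: precedes_trans lt tk.
  by exists t; rewrite !inE ?precedes_irr.
have cT : (#|T| <= (rank t).+1)%N.
  rewrite -[(rank t).+1](_ : #|[predU1 t & [pred k | precedes b k t]]| = _)%N.
    apply: subset_leq_card; apply/fintype.subsetP => k Tk; rewrite !inE.
    by case: eqP => //= /eqP; apply: sTt.
  by rewrite cardU1 inE precedes_irr.
(* If [#|J| <= rank t], the predecessors of [t] weigh at least as much as [J], hence at least [A],
   and [t] cannot start before [A]. *)
apply: leq_trans cT _; rewrite ltnNge; apply: contraL Tt => Jr.
rewrite -leqNgt; apply: leq_trans AJ _.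
pose P := [set k | precedes b k t].
have cP : #|P| = rank t by rewrite cardsE.
rewrite /lo [leqRHS](_ : _ = \sum_(k in P) b k)%N; last first.
  by apply: eq_bigl => k; rewrite inE.
rewrite (big_setID P) /= [leqRHS](big_setID J) /= [P :&: J]finset.setIC leq_add2l.
(* Exchange with pivot [b t]: weights outside [P] are at most [b t], those in [P] at least [b t],
   and [J :\: P] is no larger than [P :\: J]. *)
apply: (@leq_trans (#|J :\: P| * b t)).
  rewrite -sum_nat_const; apply: leq_sum => k; rewrite !inE => /andP[nk _].
  have [->//|kt] := eqVneq k t.
  by case/orP: (precedes_total b kt) => [kp|/precedes_key //]; rewrite kp in nk.
apply: (@leq_trans (#|P :\: J| * b t)).
  rewrite leq_mul2r; apply/orP; right.
  rewrite -(leq_add2l #|J :&: P|) cardsID finset.setIC cardsID cP; exact: Jr.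
rewrite -sum_nat_const; apply: leq_sum => k; rewrite !inE => /andP[_].
exact: precedes_key.
Qed.

(** * Overlaps of two interval layouts *)

Section Overlap.
Variables (d d' : Order.disp_t) (K : orderType d) (K' : orderType d') (n m : nat).
Variables (key : 'I_n -> K) (a : 'I_n -> nat) (key' : 'I_m -> K') (b : 'I_m -> nat).

Definition overlap i j :=
  (minn (hi key a i) (hi key' b j) - maxn (lo key a i) (lo key' b j))%N.

(** Counting the unit segments common to both intervals reduces row and column sums to an exchange
    of summations. *)
Lemma overlapE i j :
  overlap i j = (\sum_(u < \sum_k a k) meets key a u i * meets key' b u j)%N.
Proof.
have := hi_le_total key a i.
set N := (\sum_k a k)%N => hN.
rewrite /overlap -[minn _ _](_ : minn (minn (hi key a i) (hi key' b j)) N = _)%N; last by lia.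
rewrite -sum_itv; apply: eq_bigr => u _; rewrite mulnb /meets; congr nat_of_bool; lia.
Qed.

(* An overlap starts where a source interval or a sink interval starts, and that
   endpoint determines it. *)
Lemma card_overlap (S : {set 'I_n}) :
  (forall i k, k \in S -> precedes key i k -> i \in S) ->
  (#|[set e : 'I_n * 'I_m | (e.1 \in S) && (0 < overlap e.1 e.2)]|
    <= #|S| + #|[pred j | lo key' b j < \sum_(i in S) a i]|)%N.
Proof.
move=> dS; set U := [set _ | _].
(* [U1] holds the overlaps that start with the source interval, [U2] those that start strictly
   later, with the sink interval. *)
pose U1 := [set e in U | lo key' b e.2 <= lo key a e.1]%N.
pose U2 := [set e in U | lo key a e.1 < lo key' b e.2]%N.
have ->: U = U1 :|: U2.
  by apply/setP => e; rewrite !inE -andb_orr (leqNgt (lo key' b _)) orNb andbT.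
apply: leq_trans (leq_card_setU _ _) _; apply: leq_add.
  (* On [U1] the source determines the sink, as the one whose interval contains [lo key a i]. *)
  rewrite -(@card_in_imset _ _ fst U1).
    apply: subset_leq_card; apply/fintype.subsetP => i /imsetP[e].
    by rewrite !inE => /andP[/andP[eS _] _] ->.
  move=> [i j] [i' j']; rewrite !inE /= => /andP[/andP[_ o1] l1] /andP[/andP[_ o2] l2] e.
  rewrite -e in o2 l2 *; congr pair; apply: (@meets_inj _ _ _ key' b (lo key a i));
    move: o1 o2 l1 l2; rewrite /meets /overlap; lia.
(* On [U2] the sink determines the source. It starts before [hi key a i], which is at most the
   supply of [S] because [S] is closed under predecessors. *)
rewrite -(@card_in_imset _ _ snd U2).
  apply: subset_leq_card; apply/fintype.subsetP => j /imsetP[[i j0]].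
  rewrite !inE /= => /andP[/andP[eS o] _] ->.
  apply: (@leq_trans (hi key a i)); last exact: hi_le_sum (fun k => dS k _ eS).
  by move: o; rewrite /overlap; lia.
move=> [i j] [i' j']; rewrite !inE /= => /andP[/andP[_ o1] l1] /andP[/andP[_ o2] l2] e.
rewrite -e in o2 l2 *; congr pair; apply: (@meets_inj _ _ _ key a (lo key' b j));
  move: o1 o2 l1 l2; rewrite /meets /overlap; lia.
Qed.

Hypothesis bal : (\sum_i a i = \sum_j b j)%N.

(** By [bal] the sinks cover the same range as the sources, so each segment of interval [i] lies in
    exactly one sink interval. *)
Lemma sum_overlap_row i : (\sum_j overlap i j = a i)%N.
Proof.
under eq_bigr do rewrite overlapE.
rewrite exchange_big /=.
rewrite (eq_bigr (fun u : 'I_(\sum_k a k) => (meets key a u i : nat))) => [|u _]; last first.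
  by rewrite -big_distrr /= sum_meets ?muln1 // -bal.
rewrite sum_itv.
have := hi_le_total key a i.
by rewrite /hi; lia.
Qed.

Lemma sum_overlap_col j : (\sum_i overlap i j = b j)%N.
Proof.
under eq_bigr do rewrite overlapE.
rewrite exchange_big /=.
rewrite (eq_bigr (fun u : 'I_(\sum_k a k) => (meets key' b u j : nat))) => [|u _]; last first.
  by rewrite -big_distrl /= sum_meets ?mul1n.
rewrite sum_itv bal.
have := hi_le_total key' b j.
by rewrite /hi; lia.
Qed.

End Overlap.

(* Abel summation: peel off the smallest positive value of [f]. *)
Lemma ler_sum_upper (R : realFieldType) n (f g h : 'I_n -> R) :
  (forall i, 0 <= f i) ->
  (forall c, \sum_(i | c <= f i) g i <= \sum_(i | c <= f i) h i) ->
  \sum_i f i * g i <= \sum_i f i * h i.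
Proof.
have [N le] := ubnP #|[set i | f i != 0]|; elim: N f le => // N IH f leN f0 gh.
have [i0 fi0|z] := pickP (fun i => f i != 0); last first.
  by rewrite !big1 // => i _; have /negbFE/eqP-> := z i; rewrite mul0r.
have [i1 fi1 imin] := @arg_minP _ _ _ i0 (fun i => f i != 0) f fi0.
set c := f i1 in imin *; have c0 : 0 < c by rewrite lt0r fi1 f0.
(* Lowering all nonzero values by the least one turns [f i1] into 0, so the induction advances; what
   is removed is [c] times a sum over an upper set. *)
pose f' i := if c <= f i then f i - c else 0.
have split (k : 'I_n -> R) :
    \sum_i f i * k i = \sum_i f' i * k i + c * \sum_(i | c <= f i) k i.
  rewrite mulr_sumr [X in _ + X]big_mkcond -big_split /=; apply: eq_bigr => i _.
  rewrite /f'; case: ifPn => ci; first by rewrite -mulrDl subrK.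
  have [->|/imin ci'] := eqVneq (f i) 0; first by rewrite !mul0r addr0.
  by rewrite ci' in ci.
rewrite !split; apply: lerD; last by rewrite ler_pM2l.
apply: IH => [|i|e].
- rewrite -ltnS; apply: leq_trans leN; rewrite ltnS; apply: proper_card.
  apply/properP; split.
    apply/fintype.subsetP => i; rewrite !inE /f'; case: ifP => [ci _|]; last by rewrite eqxx.
    by rewrite gt_eqF // (lt_le_trans c0).
  by exists i1; rewrite !inE /f' ?lexx ?subrr ?eqxx.
- by rewrite /f'; case: ifP => //; rewrite subr_ge0.
(* Upper sets of [f'] are upper sets of [f]: at a nonpositive threshold both are everything, at
   [e > 0] the threshold for [f] is [e + c]. *)
have [e0|e0] := lerP e 0.
  have E i : (e <= f' i) = (0 <= f i).
    by rewrite f0 (le_trans e0) // /f'; case: ifP => //; rewrite subr_ge0.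
  by rewrite !(eq_bigl _ _ E).
have E i : (e <= f' i) = (e + c <= f i).
  rewrite /f'; case: ifPn => [ci|]; first by rewrite lerBrDr.
  rewrite -ltNge => ci; rewrite leNgt e0 leNgt /=; apply/esym/negbF.
  by rewrite (lt_trans ci) // ltrDr.
by rewrite !(eq_bigl _ _ E).
Qed.

(** * The approximation ratio *)

Section Approximation.
Variables (R : realType) (I : FCT R) (f : 'I_(nsrc I) -> rat).
Hypothesis HI : PFCTS I (fun i => ratr (f i)).
Local Notation n := (nsrc I).
Local Notation m := (nsnk I).
Local Notation a := (@supply R I).
Local Notation b := (@demand R I).
Local Notation ov := (overlap f a b b).

Definition solution : 'M[rat]_(n, m) := \matrix_(i, j) (ov i j)%:R.

Lemma solutionE i j : map_mx ratr solution i j = (ov i j)%:R :> R.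
Proof. by rewrite !mxE ratr_nat. Qed.

Lemma solution_feasible : feasible I (map_mx ratr solution).
Proof.
split=> [i j|i|j]; first by rewrite solutionE.
- under eq_bigr do rewrite solutionE.
  by rewrite -natr_sum sum_overlap_row //; apply: balanced.
under eq_bigr do rewrite solutionE.
by rewrite -natr_sum sum_overlap_col //; apply: balanced.
Qed.

Definition degree (x : 'M[R]_(n, m)) i := #|[set j | 0 < x i j]|.

(** Sink-independence lets the fixed cost factor out of each row, leaving a count of used pairs. *)
Lemma cost_degree x : cost I x = \sum_i ratr (f i) * (degree x i)%:R.
Proof.
case: HI => lin0 _ fixE; apply: eq_bigr => i _.
under eq_bigr do rewrite lin0 mul0r addr0 fixE.
by rewrite -big_mkcond sumr_const /degree cardsE mulr_natr.
Qed.

Lemma sum_degree x (S : {set 'I_n}) :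
  (\sum_(i in S) degree x i = #|[set e | (e.1 \in S) && (0 < x e.1 e.2)%R]|)%N.
Proof.
rewrite -sum1_card (eq_bigr (fun i => \sum_(j | (0 < x i j)%R) 1)%N) => [|i _].
  by rewrite pair_big_dep; apply: eq_bigl => e; rewrite inE.
by rewrite /degree -sum1_card; apply: eq_bigl => j; rewrite inE.
Qed.

(** [card_overlap] bounds the left side by [#|S|] plus the number of sinks starting before the
    supply of [S]; each term is at most the number of pairs that [y] uses in the rows of [S]. *)
Lemma degree_solution_le y (S : {set 'I_n}) : feasible I y ->
  (forall i k, k \in S -> precedes f i k -> i \in S) ->
  (\sum_(i in S) degree (map_mx ratr solution) i
    <= 2 * \sum_(i in S) degree y i)%N.
Proof.
move=> [y0 ya yb] dS.
(* The sinks that [y] serves from [S]; [card_lo_lt] compares their number with that of the sinks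
   starting before the supply of [S]. *)
pose J := [set j | [exists i in S, 0 < y i j]].
(* Supplies are positive, so every source of [S] uses at least one pair. *)
have SD : (#|S| <= \sum_(i in S) degree y i)%N.
  rewrite -sum1_card; apply: leq_sum => i _; rewrite lt0n; apply/eqP => /cards0_eq d0.
  have := ya i; rewrite big1 => [/esym/eqP|j _].
    by rewrite pnatr_eq0; have := supply_gt0 i; case: supply.
  apply/eqP; rewrite eq_le y0 andbT leNgt; apply/negP => yij.
  by have := finset.in_set0 j; rewrite -d0 inE yij.
have JD : (#|J| <= \sum_(i in S) degree y i)%N.
  rewrite sum_degree; apply: leq_trans (leq_imset_card snd _).
  apply: subset_leq_card; apply/fintype.subsetP => j; rewrite inE.
  by case/existsP=> i /andP[iS yij]; apply/imsetP; exists (i, j); rewrite ?inE ?iS.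
(* All flow out of [S] ends in [J]. *)
have AJ : (\sum_(i in S) a i <= \sum_(j in J) b j)%N.
  rewrite -(ler_nat R) !natr_sum.
  rewrite -(eq_bigr _ (fun i _ => ya i)) -(eq_bigr _ (fun j _ => yb j)).
  rewrite (exchange_big_dep predT) //= [leRHS]big_mkcond /=; apply: ler_sum => j _.
  case: ifPn => jJ.
    by rewrite [leRHS](bigID (mem S)) /= (eq_bigl (mem S)) => [|i]; rewrite ?andbT // lerDl sumr_ge0.
  rewrite big1 // => i /andP[iS _]; apply/eqP; rewrite eq_le y0 andbT leNgt.
  apply: contra jJ => yij; rewrite inE; apply/existsP; exists i; exact/andP.
have := @card_overlap _ _ _ _ _ _ f a b b S dS; have := card_lo_lt AJ.
rewrite sum_degree => h1 h2.
have -> : [set e | (e.1 \in S) && (0 < map_mx ratr solution e.1 e.2 :> R)]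
    = [set e : 'I_n * 'I_m | (e.1 \in S) && (0 < ov e.1 e.2)%N].
  by apply/setP => e; rewrite !inE solutionE ltr0n.
apply: leq_trans h2 _; rewrite mul2n -addnn; apply: leq_add => //.
exact: leq_trans h1 JD.
Qed.

Lemma solution_cost : cost I (map_mx ratr solution) <= 2 * opt I.
Proof.
rewrite mulrC -ler_pdivrMr //; apply: lb_le_inf.
  exists (cost I (map_mx ratr solution)), (map_mx ratr solution) => //.
  exact: solution_feasible.
move=> _ [y fy <-]; rewrite ler_pdivrMr // mulrC !cost_degree mulr_sumr.
have [_ f0 _] := HI.
under [leRHS]eq_bigr do rewrite mulrCA.
apply: ler_sum_upper => // c.
rewrite -mulr_sumr -!natr_sum -natrM ler_nat.
pose S := [set i | c <= ratr (f i) :> R].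
have SE (g : 'I_n -> nat) : (\sum_(i | (c <= ratr (f i))%R) g i = \sum_(i in S) g i)%N.
  by apply: eq_bigl => i; rewrite inE.
(* Predecessors have at least the same fixed cost, so the sources above a threshold are closed under
   predecessors. *)
rewrite !SE; apply: degree_solution_le => // i k; rewrite !inE => ck /precedes_key ik.
by apply: le_trans ck _; rewrite ler_rat.
Qed.

End Approximation.

(** * Structured code for the machine *)

(* Code as a function of the address at which it is placed. *)
Definition code := nat -> seq instr.

Definition blk (b : seq instr) : code := fun=> b.
Definition seqc (c d : code) : code := fun p => c p ++ d (p + size (c p))%N.
Definition unlesspos (i : nat) (c : code) : code :=
  fun p => IJpos i (p.+1 + size (c p.+1))%N :: c p.+1.
(* A do-while loop: [c] runs at least once, and again while X_i > 0. *)
Definition rep (c : code) (i : nat) : code := fun p => rcons (c p) (IJpos i p).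

(* Registers below [nreg] are scratch variables; the others hold the input. *)
Definition nreg := 15%N.

(** The scratch registers form a concrete list, so that accesses at fixed indices reduce by
    computation; the memory stays a function. *)
Record state := State {
  regs : seq int;
  memory : nat -> int;
  inp : seq int;
  outp : seq int
}.

Definition regfile (s : seq int) (mm : nat -> int) : nat -> int :=
  fun k => if (k < nreg)%N then s`_k else mm (k - nreg)%N.

Definition conf (p : nat) (s : state) : config :=
  Config p (regfile (regs s) (memory s)) (inp s) (outp s).

(** [halts_in] describes complete executions only, so a fragment is specified by the cost it adds to
    any halting run from its exit, inside any surrounding program. *)
Definition steps (c : code) (s : state) (t : nat) (s' : state) :=
  forall pre post u e,
    halts_in (pre ++ c (size pre) ++ post)
      (conf (size pre + size (c (size pre)))%N s') u e ->
    halts_in (pre ++ c (size pre) ++ post) (conf (size pre) s) (t + u)%N e.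

(* [k] bounds the number of instructions, each of cost at most [L]. *)
Definition run (L : nat) (c : code) (k : nat) (s : state) (Q : state -> Prop) :=
  exists t s', [/\ steps c s t s', (t <= k * L)%N & Q s'].

Lemma upd_regfile s mm i z : (i < nreg)%N ->
  upd (regfile s mm) i z = regfile (set_nth 0 s i z) mm.
Proof.
move=> ltin; apply/funext => k; rewrite /upd /regfile nth_set_nth /=.
by case: eqP => [->|_]; rewrite ?ltin.
Qed.

Lemma upd_mem s mm k z :
  upd (regfile s mm) (nreg + k) z = regfile s (upd mm k z).
Proof.
apply/funext => l; rewrite /upd /regfile.
case: (ltnP l nreg) => [lt|le]; first by case: eqP => // le; lia.
by rewrite (_ : (l == nreg + k) = (l - nreg == k))%N //; lia.
Qed.

Lemma onth_catr (T : Type) (s1 s2 : seq T) k :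
  onth (s1 ++ s2) (size s1 + k) = onth s2 k.
Proof. by elim: s1. Qed.

(** * Cost-bounded rules for structured code *)

Section Run.
Variable L : nat.

Lemma run_weaken c k k' s (Q Q' : state -> Prop) : (k <= k')%N ->
  (forall s', Q s' -> Q' s') -> run L c k s Q -> run L c k' s Q'.
Proof.
move=> lek QQ' [t [s' [st tk q]]]; exists t, s'; split=> //; last exact: QQ'.
by apply: leq_trans tk _; rewrite leq_mul2r lek orbT.
Qed.

Lemma run_nil s (Q : state -> Prop) : Q s -> run L (blk [::]) 0 s Q.
Proof.
by move=> q; exists 0%N, s; split=> // pre post u e; rewrite add0n addn0.
Qed.

Lemma run_ins ins b k s s1 Q :
  (forall p, exec_instr ins (conf p s) = Some (conf p.+1 s1)) ->
  (instr_cost ins (conf 0 s) <= L)%N ->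
  run L (blk b) k s1 Q -> run L (blk (ins :: b)) k.+1 s Q.
Proof.
move=> ex ci [t [s' [st tk q]]].
exists (instr_cost ins (conf 0 s) + t)%N, s'; split=> //; last first.
  by rewrite mulSn leq_add.
move=> pre post u e h; rewrite -addnA.
have cE : instr_cost ins (conf 0 s) = instr_cost ins (conf (size pre) s) by [].
rewrite cE; apply: (HaltsStep (c1 := conf (size pre).+1 s1)) => //.
  by rewrite -[pc _]addn0 onth_catr.
have:= st (rcons pre ins) post u e.
rewrite !size_rcons cat_rcons /blk; apply.
by move: h; rewrite /blk /= addnS addSn.
Qed.

Lemma run_seq c d k1 k2 s Q :
  run L c k1 s (fun s1 => run L d k2 s1 Q) -> run L (seqc c d) (k1 + k2) s Q.
Proof.
move=> [t1 [s1 [st1 le1 [t2 [s2 [st2 le2 q]]]]]].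
exists (t1 + t2)%N, s2; split=> //; last by rewrite mulnDl leq_add.
move=> pre post u e; rewrite /seqc -catA size_cat => h; rewrite -addnA.
apply: st1.
have := st2 (pre ++ c (size pre)) post u e.
by rewrite size_cat -catA; apply; rewrite -addnA.
Qed.

Lemma run_unlesspos i c k s Q : (i < nreg)%N -> (bitlen (regs s)`_i <= L)%N ->
  (0 < (regs s)`_i -> Q s) -> ((regs s)`_i <= 0 -> run L c k s Q) ->
  run L (unlesspos i c) k.+1 s Q.
Proof.
move=> ltin ci q r; have rE : regfile (regs s) (memory s) i = (regs s)`_i.
  by rewrite /regfile ltin.
case: (ltrP 0 (regs s)`_i) => [gt0|le0].
  exists (bitlen (regs s)`_i), s; split; last exact: q.
    move=> pre post u e h.
    have cE : bitlen (regs s)`_i =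
        instr_cost (IJpos i ((size pre).+1 + size (c (size pre).+1)))
          (conf (size pre) s) by rewrite /= rE.
    rewrite cE.
    apply: (HaltsStep (c1 := conf (size pre + size (unlesspos i c (size pre))) s)) => //.
      by rewrite -[pc _]addn0 onth_catr.
    by rewrite /= rE gt0 addSnnS.
  by rewrite mulSn; apply: leq_trans ci (leq_addr _ _).
have [t [s' [st tk q']]] := r le0.
exists (bitlen (regs s)`_i + t)%N, s'; split=> //; last by rewrite mulSn leq_add.
move=> pre post u e h; rewrite -addnA.
have cE : bitlen (regs s)`_i =
    instr_cost (IJpos i ((size pre).+1 + size (c (size pre).+1)))
      (conf (size pre) s) by rewrite /= rE.
rewrite cE; apply: (HaltsStep (c1 := conf (size pre).+1 s)) => //.
- by rewrite -[pc _]addn0 onth_catr.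
- by rewrite /= rE ltNge le0.
have := st (rcons pre (IJpos i ((size pre).+1 + size (c (size pre).+1)))) post u e.
rewrite size_rcons cat_rcons; apply.
by move: h; rewrite /unlesspos /= addnS addSn.
Qed.

(** [Inv j] describes the state after [j] rounds; the extra unit per round pays for the jump. The
    proof is by induction on the rounds left, of which a do-while loop has at least one. *)
Lemma run_rep c k i N (Inv : nat -> state -> Prop) s : (i < nreg)%N ->
  (forall j s1, (j < N)%N -> Inv j s1 -> run L c k s1 (fun s2 =>
     [/\ Inv j.+1 s2, (bitlen (regs s2)`_i <= L)%N
       & (0 < (regs s2)`_i) = (j.+1 < N)%N])) ->
  (0 < N)%N -> Inv 0%N s -> run L (rep c i) (N * k.+1) s (Inv N).
Proof.
move=> ltin body N0 I0.
suff gen d j s1 : (j + d.+1 = N)%N -> Inv j s1 ->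
    run L (rep c i) (d.+1 * k.+1) s1 (Inv N).
  have := gen N.-1 0%N s; rewrite add0n prednK //; exact.
elim: d j s1 => [|d IH] j s1 jd Ij.
all: have jN : (j < N)%N by lia.
all: have [t [s2 [st tk [I2 b2 c2]]]] := body j s1 jN Ij.
all: have rE : regfile (regs s2) (memory s2) i = (regs s2)`_i by rewrite /regfile ltin.
all: have cE p : bitlen (regs s2)`_i = instr_cost (IJpos i p) (conf (p + size (c p)) s2)
  by rewrite /= rE.
- exists (t + bitlen (regs s2)`_i)%N, s2; split; last 1 first.
  + by move: I2; have ->: j.+1 = N by lia.
  + move=> pre post u e; rewrite /rep -cats1 -catA /= size_cat /= addn1 => h.
    rewrite -addnA; apply: st; rewrite (cE (size pre)).
    apply: HaltsStep h => /=.
      by rewrite catA -size_cat -[(size (_ ++ _))]addn0 onth_catr.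
    rewrite rE c2 ifF ?addnS //; lia.
  + by rewrite mul1n mulSn addnC leq_add.
have [|t' [s' [st' tk' q]]] := IH j.+1 s2 _ I2; first by lia.
exists (t + bitlen (regs s2)`_i + t')%N, s'; split=> //; last first.
  by rewrite mulSn mulnDl leq_add // mulSn addnC leq_add.
move=> pre post u e /st'; rewrite /rep -cats1 -catA /= => h.
rewrite -!addnA; apply: st; rewrite (cE (size pre)).
apply: HaltsStep h => /=.
  by rewrite catA -size_cat -[(size (_ ++ _))]addn0 onth_catr.
rewrite rE c2 ifT //; lia.
Qed.

Lemma run_halts c k s Q : run L c k s Q -> exists t s',
  [/\ halts_in (c 0%N) (conf 0 s) t (conf (size (c 0%N)) s'), (t <= k * L)%N & Q s'].
Proof.
move=> [t [s' [st tk q]]]; exists t, s'; split=> //.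
have := st [::] [::] 0%N (conf (size (c 0%N)) s'); rewrite /= cats0 add0n addn0.
by apply; apply: HaltsNow.
Qed.

End Run.

(** * Rules for single instructions *)

Section Instr.
Variables (E : nat) (b : seq instr) (k : nat) (Q : state -> Prop).
Variables (s : seq int) (mm : nat -> int) (w o : seq int).
(** An instruction is charged for at most two numbers, each of at most [E.+1] bits if it [fits]. *)
Let L := (2 * E.+1)%N.

Definition fits (z : int) : Prop := (`|z|%N <= 2 ^ E)%N.

Lemma bitlen_fits z : fits z -> (bitlen z <= E.+1)%N.
Proof.
move=> fz; rewrite /bitlen ltnS; apply: leq_trans (leq_trunc_log _ fz) _.
by rewrite trunc_expnK.
Qed.

Lemma bitlen_fits2 z : fits z -> (bitlen z <= L)%N.
Proof. by move/bitlen_fits; rewrite /L; lia. Qed.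

Lemma run_const i z : (i < nreg)%N ->
  run L (blk b) k (State (set_nth 0 s i z) mm w o) Q ->
  run L (blk (IConst i z :: b)) k.+1 (State s mm w o) Q.
Proof.
by move=> ?; apply: run_ins => [p|]; rewrite /= /conf /= ?upd_regfile.
Qed.

Lemma run_add i j l : [&& i < nreg, j < nreg & l < nreg]%N ->
  fits s`_j -> fits s`_l ->
  run L (blk b) k (State (set_nth 0 s i (s`_j + s`_l)) mm w o) Q ->
  run L (blk (IAdd i j l :: b)) k.+1 (State s mm w o) Q.
Proof.
move=> /and3P[hi hj hl] /bitlen_fits fj /bitlen_fits fl.
apply: run_ins => [p|]; rewrite /= /conf /= ?upd_regfile // /regfile hj hl //.
by rewrite /L mul2n -addnn leq_add.
Qed.

Lemma run_sub i j l : [&& i < nreg, j < nreg & l < nreg]%N ->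
  fits s`_j -> fits s`_l ->
  run L (blk b) k (State (set_nth 0 s i (s`_j - s`_l)) mm w o) Q ->
  run L (blk (ISub i j l :: b)) k.+1 (State s mm w o) Q.
Proof.
move=> /and3P[hi hj hl] /bitlen_fits fj /bitlen_fits fl.
apply: run_ins => [p|]; rewrite /= /conf /= ?upd_regfile // /regfile hj hl //.
by rewrite /L mul2n -addnn leq_add.
Qed.

Lemma run_mul i j l : [&& i < nreg, j < nreg & l < nreg]%N ->
  fits s`_j -> fits s`_l ->
  run L (blk b) k (State (set_nth 0 s i (s`_j * s`_l)) mm w o) Q ->
  run L (blk (IMul i j l :: b)) k.+1 (State s mm w o) Q.
Proof.
move=> /and3P[hi hj hl] /bitlen_fits fj /bitlen_fits fl.
apply: run_ins => [p|]; rewrite /= /conf /= ?upd_regfile // /regfile hj hl //.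
by rewrite /L mul2n -addnn leq_add.
Qed.

Lemma run_fetch a i j : (i < nreg)%N && (j < nreg)%N ->
  s`_j = (nreg + a)%N :> int -> fits s`_j -> fits (mm a) ->
  run L (blk b) k (State (set_nth 0 s i (mm a)) mm w o) Q ->
  run L (blk (IFetch i j :: b)) k.+1 (State s mm w o) Q.
Proof.
move=> /andP[hi hj] sj; rewrite sj => /bitlen_fits fj /bitlen_fits fl.
have rE : regfile s mm (nreg + a)%N = mm a.
  by rewrite /regfile ltnNge leq_addr /= addKn.
have rj : regfile s mm j = (nreg + a)%N :> int by rewrite -sj /regfile hj.
apply: run_ins => [p|]; cbn [exec_instr instr_cost conf regs memory inp outp].
  by rewrite rj rE upd_regfile.
by rewrite rj absz_nat rE /L mul2n -addnn leq_add.
Qed.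

Lemma run_store a i j : (i < nreg)%N && (j < nreg)%N ->
  s`_i = (nreg + a)%N :> int -> fits s`_i -> fits s`_j ->
  run L (blk b) k (State s (upd mm a s`_j) w o) Q ->
  run L (blk (IStore i j :: b)) k.+1 (State s mm w o) Q.
Proof.
move=> /andP[hi hj] sj; rewrite sj => /bitlen_fits fj /bitlen_fits fl.
have ri : regfile s mm i = (nreg + a)%N :> int by rewrite -sj /regfile hi.
have rj : regfile s mm j = s`_j by rewrite /regfile hj.
apply: run_ins => [p|]; cbn [exec_instr instr_cost conf regs memory inp outp].
  by rewrite ri upd_mem rj.
by rewrite ri rj /L mul2n -addnn leq_add.
Qed.

Lemma run_read z i : (i < nreg)%N -> fits z ->
  run L (blk b) k (State (set_nth 0 s i z) mm w o) Q ->
  run L (blk (IRead i :: b)) k.+1 (State s mm (z :: w) o) Q.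
Proof.
move=> hi /bitlen_fits2 fz.
by apply: run_ins => [p|]; rewrite /= /conf /= ?upd_regfile.
Qed.

Lemma run_print i : (i < nreg)%N -> fits s`_i ->
  run L (blk b) k (State s mm w (rcons o s`_i)) Q ->
  run L (blk (IPrint i :: b)) k.+1 (State s mm w o) Q.
Proof.
move=> hi /bitlen_fits2 fz.
by apply: run_ins => [p|]; rewrite /= /regfile hi.
Qed.

End Instr.

(** * The program *)

(* Constant registers: X_0 = 1, X_1 = n, X_2 = m, and X_3, X_4, X_5 the base
   addresses of the supplies, the demands and the fractions. Then X_6 = i,
   X_7 and X_8 the endpoints of the interval of source i, X_9 = j, X_11 the left
   endpoint of the interval of sink j. While X_7 is being computed, X_9 and X_10
   hold the fraction f_i and X_11 runs over the sources. *)
Definition load_loop := rep (blk [:: IRead 6; IStore 4 6; IAdd 4 4 0; ISub 5 5 0]) 5.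

(** Fractions are compared by cross-multiplication. X_13 ends as 1 minus the test value, hence
    positive exactly when source X_11 does not come before source X_6: [unlesspos] then skips the
    addition. *)
Definition source_test := blk
  [:: IAdd 12 11 11; IAdd 12 5 12; IFetch 13 12; IAdd 12 12 0; IFetch 14 12;
      IMul 13 13 10; IMul 14 14 9; ISub 13 13 14; IMul 13 13 1; IAdd 13 13 6;
      ISub 13 13 11; ISub 13 0 13].

Definition source_loop := rep
  (seqc source_test
  (seqc (unlesspos 13 (blk [:: IAdd 12 3 11; IFetch 12 12; IAdd 7 7 12]))
        (blk [:: IAdd 11 11 0; ISub 12 1 11]))) 12.

Definition sink_test := blk
  [:: IAdd 13 4 12; IFetch 13 13; ISub 14 13 10; IMul 14 14 2; IAdd 14 14 9;
      ISub 14 14 12; ISub 14 0 14].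

Definition sink_loop := rep
  (seqc sink_test
  (seqc (unlesspos 14 (blk [:: IAdd 11 11 13]))
        (blk [:: IAdd 12 12 0; ISub 13 2 12]))) 13.

(** X_12 becomes the smaller right endpoint and X_10 the larger left endpoint, with X_14 = 0 used
    for copying; the difference, clipped at 0, is printed over the denominator X_0 = 1. *)
Definition cell_loop := rep
  (seqc (blk [:: IAdd 10 4 9; IFetch 10 10; IConst 11 0; IConst 12 0])
  (seqc sink_loop
  (seqc (blk [:: IAdd 10 11 10; IConst 14 0; IAdd 12 8 14; ISub 13 10 12])
  (seqc (unlesspos 13 (blk [:: IAdd 12 10 14]))
  (seqc (blk [:: IAdd 10 7 14; ISub 13 10 11])
  (seqc (unlesspos 13 (blk [:: IAdd 10 11 14]))
  (seqc (blk [:: ISub 12 12 10])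
  (seqc (unlesspos 12 (blk [:: IConst 12 0]))
        (blk [:: IPrint 12; IPrint 0; IAdd 9 9 0; ISub 12 2 9]))))))))) 12.

Definition row_loop := rep
  (seqc (blk [:: IAdd 8 6 6; IAdd 8 5 8; IFetch 9 8; IAdd 8 8 0; IFetch 10 8;
                 IConst 7 0; IConst 11 0])
  (seqc source_loop
  (seqc (blk [:: IAdd 8 3 6; IFetch 8 8; IAdd 8 7 8; IConst 9 0])
  (seqc cell_loop
        (blk [:: IAdd 6 6 0; ISub 7 1 6]))))) 7.

(* X_3 = 1 - n > 0 on the empty instance, where no do-while loop may start. *)
Definition main_code :=
  seqc (blk [:: IRead 1; IRead 2; IConst 0 1; ISub 3 0 1])
  (unlesspos 3
    (seqc (blk [:: IConst 4 nreg; IAdd 5 1 1; IAdd 5 5 1; IAdd 5 5 2])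
    (seqc load_loop
    (seqc (blk [:: IConst 3 nreg; IAdd 4 3 1; IAdd 5 4 2; IConst 6 0])
          row_loop)))).

Definition psum (P : pred nat) (a : nat -> int) (t : nat) : int :=
  \sum_(k < t) (if P k then a k else 0).

Lemma psumS P a t : psum P a t.+1 = psum P a t + (if P t then a t else 0).
Proof. by rewrite /psum big_ord_recr. Qed.

(** * Verification of the loops on an abstract input word *)

Section Program.
Variables (n m : nat) (w : seq int).

Definition mem_a k := w`_k.
Definition mem_b k := w`_(n + k).
Definition mem_p k := w`_(n + m + 2 * k).
Definition mem_q k := w`_(n + m + 2 * k + 1).

(** Has the sign of f_k - f_i when denominators are positive; the factor [n] lets a nonzero
    difference outweigh the index difference added in [src_before]. *)
Definition src_cmp i k : int := (mem_p k * mem_q i - mem_q k * mem_p i) * n.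
Definition snk_cmp j k : int := (mem_b k - mem_b j) * m.

Definition src_before i k := 0 < src_cmp i k + i%:Z - k%:Z.
Definition snk_before j k := 0 < snk_cmp j k + j%:Z - k%:Z.

Definition src_lo i := psum (src_before i) mem_a n.
Definition snk_lo j := psum (snk_before j) mem_b m.

Definition cell i j : int :=
  let d := Num.min (src_lo i + mem_a i) (snk_lo j + mem_b j)
             - Num.max (src_lo i) (snk_lo j) in
  if d <= 0 then 0 else d.

Definition row_out i t := flatten [seq [:: cell i j; 1] | j <- iota 0 t].
Definition all_out t := flatten [seq row_out i m | i <- iota 0 t].

Variables (E M : nat).
Hypothesis ME : M = (2 ^ E)%N.
Let L := (2 * E.+1)%N.

(** The slack factor 8 lets sums of a few small numbers still fit. *)
Definition small (z : int) : Prop := (8 * `|z| <= M)%N.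

Hypothesis n_gt0 : (0 < n)%N.
Hypothesis m_gt0 : (0 < m)%N.
Hypothesis Hw : size w = (3 * n + m)%N.
Hypothesis Hs : (8 * (nreg + 3 * n + m + 1) <= M)%N.
Hypothesis Hm : forall k, small w`_k.
Hypothesis Hpq : forall i k, (i < n)%N -> (k < n)%N -> small (mem_p k * mem_q i).
Hypothesis Hcmp : forall i k, (i < n)%N -> (k < n)%N -> small (src_cmp i k).
Hypothesis Hcmp' : forall j k, (j < m)%N -> (k < m)%N -> small (snk_cmp j k).
Hypothesis HA : forall P t, (t <= n)%N -> small (psum P mem_a t).
Hypothesis HB : forall P t, (t <= m)%N -> small (psum P mem_b t).

Lemma fitsI z : (`|z| <= M)%N -> fits E z.
Proof. by rewrite ME. Qed.

Let mm k := w`_k.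

Lemma smallW z : small z -> fits E z.
Proof. by rewrite /small => h; apply: fitsI; lia. Qed.

Local Ltac fit := first [assumption | apply: smallW; assumption
  | apply: fitsI; move: Hs; rewrite /nreg; lia].
Local Ltac nrm := cbn [nth set_nth regs].
Local Ltac fetch a := apply: (run_fetch (a := a));
  [by [] | nrm; rewrite /nreg; lia | nrm; fit | nrm; fit | nrm].
Local Ltac arith lem := apply: lem;
  [by [] | nrm; fit | nrm; fit | nrm].
Local Ltac const := apply: run_const; [by [] | nrm].
Local Ltac stop := apply: run_nil.
Local Ltac consl := repeat match goal with
  |- cons _ _ = cons _ _ => apply: (congr2 cons) end;
  first [exact: erefl | rewrite /nreg; lia].
Local Ltac bl := apply: bitlen_fits2; nrm; fit.

(** The existential entries are scratch registers holding leftovers of earlier computations. *)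
Definition src_inv i o t st := exists x8 x12 x13 x14,
  st = State [:: 1; n%:Z; m%:Z; nreg%:Z; (nreg + n)%N%:Z; (nreg + n + m)%N%:Z;
    i%:Z; psum (src_before i) mem_a t; x8; mem_p i; mem_q i; t%:Z; x12; x13; x14]
    mm [::] o.

Lemma run_source_loop i o s : (i < n)%N -> src_inv i o 0 s ->
  run L source_loop (n * 19) s (src_inv i o n).
Proof.
move=> lin; apply: run_rep => // t _ ltn [x8 [x12 [x13 [x14 ->]]]].
have h1 := Hpq lin ltn; have h2 := Hpq ltn lin; have h3 := Hcmp lin ltn.
rewrite mulrC in h2.
have h4 : small (mem_p t) := Hm _; have h5 : small (mem_q t) := Hm _.
have h6 : small (mem_p i) := Hm _; have h7 : small (mem_q i) := Hm _.
have h8 := HA (src_before i) (ltnW ltn); have h9 : small (mem_a t) := Hm _.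
have f1 : fits E (mem_p t * mem_q i - mem_q t * mem_p i).
  by apply: fitsI; move: h1 h2; rewrite /small; lia.
have f2 : fits E (src_cmp i t + i) by apply: fitsI; move: h3 Hs; rewrite /small; lia.
have f3 : fits E (src_cmp i t + i - t%:Z).
  by apply: fitsI; move: h3 Hs; rewrite /small; lia.
have f4 : fits E (1 - (src_cmp i t + i - t%:Z)).
  by apply: fitsI; move: h3 Hs; rewrite /small; lia.
have e1 : mm (n + m + 2 * t) = mem_p t by [].
have e2 : mm (n + m + 2 * t + 1) = mem_q t by [].
have e3 : mm t = mem_a t by [].
have e4 : (mem_p t * mem_q i - mem_q t * mem_p i) * n%:Z = src_cmp i t by [].
(* 12 instructions for the test, 1 + 3 for the guarded addition, 2 for the counter; the loop jump
   makes 19. *)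
apply: (@run_seq _ _ _ 12 6).
arith run_add. arith run_add. fetch (n + m + 2 * t)%N. arith run_add.
fetch (n + m + 2 * t + 1)%N. rewrite e1 e2.
arith run_mul. arith run_mul. arith run_sub. arith run_mul. rewrite e4.
arith run_add. arith run_sub. arith run_sub. stop.
apply: (@run_seq _ _ _ 4 2); apply: run_unlesspos => //; nrm; [bl | |].
  move=> c0; arith run_add; arith run_sub; stop; split; first last.
  - nrm; lia.
  - bl.
  - do 4!eexists; congr State; rewrite psumS /src_before.
    rewrite ifF ?addr0; last by lia.
    consl.
move=> c0.
arith run_add. fetch t. arith run_add. stop. arith run_add. arith run_sub. stop.
split; first last.
- nrm; lia.
- bl.
do 4!eexists; congr State; rewrite psumS /src_before.
rewrite ifT; last by lia.
consl.
Qed.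

Definition snk_inv i o j t st := exists x13 x14,
  st = State [:: 1; n%:Z; m%:Z; nreg%:Z; (nreg + n)%N%:Z; (nreg + n + m)%N%:Z;
    i%:Z; src_lo i; src_lo i + mem_a i; j%:Z; mem_b j;
    psum (snk_before j) mem_b t; t%:Z; x13; x14] mm [::] o.

Lemma run_sink_loop i o j s : (j < m)%N -> snk_inv i o j 0 s ->
  run L sink_loop (m * 12) s (snk_inv i o j m).
Proof.
move=> ljm; apply: run_rep => // t _ ltm [x13 [x14 ->]].
have h3 := Hcmp' ljm ltm.
have h4 : small (mem_b t) := Hm _; have h5 : small (mem_b j) := Hm _.
have h8 := HB (snk_before j) (ltnW ltm).
have f1 : fits E (mem_b t - mem_b j).
  by apply: fitsI; move: h4 h5; rewrite /small; lia.
have f2 : fits E (snk_cmp j t + j) by apply: fitsI; move: h3 Hs; rewrite /small; lia.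
have f3 : fits E (snk_cmp j t + j - t%:Z).
  by apply: fitsI; move: h3 Hs; rewrite /small; lia.
have f4 : fits E (1 - (snk_cmp j t + j - t%:Z)).
  by apply: fitsI; move: h3 Hs; rewrite /small; lia.
have e1 : mm (n + t) = mem_b t by [].
have e4 : (mem_b t - mem_b j) * m%:Z = snk_cmp j t by [].
apply: (@run_seq _ _ _ 7 4).
arith run_add. fetch (n + t)%N. rewrite e1.
arith run_sub. arith run_mul. rewrite e4.
arith run_add. arith run_sub. arith run_sub. stop.
apply: (@run_seq _ _ _ 2 2); apply: run_unlesspos => //; nrm; [bl | |].
  move=> c0; arith run_add; arith run_sub; stop; split; first last.
  - nrm; lia.
  - bl.
  - do 2!eexists; congr State; rewrite psumS /snk_before.
    rewrite ifF ?addr0; last by lia.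
    consl.
move=> c0.
arith run_add. stop. arith run_add. arith run_sub. stop.
split; first last.
- nrm; lia.
- bl.
do 2!eexists; congr State; rewrite psumS /snk_before.
rewrite ifT; last by lia.
consl.
Qed.

Lemma row_outS i t : row_out i t.+1 = row_out i t ++ [:: cell i t; 1].
Proof. by rewrite /row_out -addn1 iotaD map_cat flatten_cat. Qed.

Lemma all_outS t : all_out t.+1 = all_out t ++ row_out t m.
Proof. by rewrite /all_out -addn1 iotaD map_cat flatten_cat /= cats0. Qed.

Definition cell_inv i o t st := exists x10 x11 x12 x13 x14,
  st = State [:: 1; n%:Z; m%:Z; nreg%:Z; (nreg + n)%N%:Z; (nreg + n + m)%N%:Z;
    i%:Z; src_lo i; src_lo i + mem_a i; t%:Z; x10; x11; x12; x13; x14]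
    mm [::] (o ++ row_out i t).

Lemma run_cell_loop i o s : (i < n)%N -> cell_inv i o 0 s ->
  run L cell_loop (m * (m * 12 + 22)) s (cell_inv i o m).
Proof.
move=> lin; rewrite addnS; apply: run_rep => // t _ ltm [x10 [x11 [x12 [x13 [x14 ->]]]]].
have h1 : small (src_lo i) := HA _ (leqnn n); have h2 : small (mem_a i) := Hm _.
have h3 : small (snk_lo t) := HB _ (leqnn m); have h4 : small (mem_b t) := Hm _.
have f1 : fits E (src_lo i + mem_a i).
  by apply: fitsI; move: h1 h2; rewrite /small; lia.
have f2 : fits E (snk_lo t + mem_b t).
  by apply: fitsI; move: h3 h4; rewrite /small; lia.
have e1 : mm (n + t) = mem_b t by [].
apply: (run_weaken (k := (4 + (m * 12 + (4 + (2 + (2 + (2 + (1 + (2 + 4))))))))%N)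
  _ (fun _ h => h)); first by lia.
apply: run_seq; arith run_add; fetch (n + t)%N; const; const; stop.
rewrite e1; apply: run_seq.
apply: run_weaken (leqnn _) _ (run_sink_loop ltm _); last first.
  by do 2!eexists; rewrite /psum big_ord0.
move=> _ [y13 [y14 ->]]; rewrite -/(snk_lo t).
apply: run_seq; arith run_add; const; arith run_add; rewrite addr0.
arith run_sub; stop; apply: run_seq.
pose hi := Num.min (src_lo i + mem_a i) (snk_lo t + mem_b t).
pose lo := Num.max (src_lo i) (snk_lo t).
have f3 : fits E (snk_lo t + mem_b t - (src_lo i + mem_a i)).
  by apply: fitsI; move: h1 h2 h3 h4; rewrite /small; lia.
have f4 : fits E (src_lo i - snk_lo t).
  by apply: fitsI; move: h1 h3; rewrite /small; lia.
have f5 : fits E hi.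
  by apply: fitsI; move: h1 h2 h3 h4; rewrite /small /hi; lia.
have f6 : fits E lo.
  by apply: fitsI; move: h1 h2 h3 h4; rewrite /small /lo; lia.
have f7 : fits E (hi - lo).
  by apply: fitsI; move: h1 h2 h3 h4; rewrite /small /hi /lo; lia.
(* Both branches of the conditional end with [hi] in X_12, so the rest is run once, for arbitrary
   contents of X_10 and X_13. The next two conditionals are treated likewise. *)
suff R y10 z y13' : z = hi -> run L
  (seqc (blk [:: IAdd 10 7 14; ISub 13 10 11])
  (seqc (unlesspos 13 (blk [:: IAdd 10 11 14]))
  (seqc (blk [:: ISub 12 12 10])
  (seqc (unlesspos 12 (blk [:: IConst 12 0]))
        (blk [:: IPrint 12; IPrint 0; IAdd 9 9 0; ISub 12 2 9])))))
  (2 + (2 + (1 + (2 + 4))))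
  (State [:: 1; n%:Z; m%:Z; nreg%:Z; (nreg + n)%N%:Z; (nreg + n + m)%N%:Z;
    i%:Z; src_lo i; src_lo i + mem_a i; t%:Z; y10; snk_lo t; z; y13'; 0]
    mm [::] (o ++ row_out i t))
  (fun s2 => [/\ cell_inv i o t.+1 s2, (bitlen (regs s2)`_12 <= L)%N
    & (0 < (regs s2)`_12) = (t.+1 < m)%N]).
  apply: run_unlesspos; [by [] | bl | nrm => c0 | nrm => c0].
    by apply: R; rewrite /hi; lia.
  by arith run_add; stop; rewrite addr0; apply: R; rewrite /hi; lia.
move=> -> {z}; apply: run_seq; arith run_add; rewrite addr0; arith run_sub; stop; apply: run_seq.
suff R z z11 z13 : z = lo -> run L
  (seqc (blk [:: ISub 12 12 10])
  (seqc (unlesspos 12 (blk [:: IConst 12 0]))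
        (blk [:: IPrint 12; IPrint 0; IAdd 9 9 0; ISub 12 2 9])))
  (1 + (2 + 4))
  (State [:: 1; n%:Z; m%:Z; nreg%:Z; (nreg + n)%N%:Z; (nreg + n + m)%N%:Z;
    i%:Z; src_lo i; src_lo i + mem_a i; t%:Z; z; z11; hi; z13; 0]
    mm [::] (o ++ row_out i t))
  (fun s2 => [/\ cell_inv i o t.+1 s2, (bitlen (regs s2)`_12 <= L)%N
    & (0 < (regs s2)`_12) = (t.+1 < m)%N]).
  apply: run_unlesspos; [by [] | bl | nrm => c0 | nrm => c0].
    by apply: R; rewrite /lo; lia.
  by arith run_add; stop; rewrite addr0; apply: R; rewrite /lo; lia.
move=> ->; apply: run_seq; arith run_sub; stop; apply: run_seq.
suff R c z14 : c = cell i t -> run L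
  (blk [:: IPrint 12; IPrint 0; IAdd 9 9 0; ISub 12 2 9]) 4
  (State [:: 1; n%:Z; m%:Z; nreg%:Z; (nreg + n)%N%:Z; (nreg + n + m)%N%:Z;
    i%:Z; src_lo i; src_lo i + mem_a i; t%:Z; lo; z11; c; z13; z14]
    mm [::] (o ++ row_out i t))
  (fun s2 => [/\ cell_inv i o t.+1 s2, (bitlen (regs s2)`_12 <= L)%N
    & (0 < (regs s2)`_12) = (t.+1 < m)%N]).
  apply: run_unlesspos; [by [] | bl | nrm => c0 | nrm => c0].
    by apply: R; rewrite /cell ifF //; apply/negbTE; rewrite -ltNge.
  by const; stop; apply: R; rewrite /cell ifT.
move=> ->.
have f8 : fits E (cell i t).
  by apply: fitsI; move: h1 h2 h3 h4; rewrite /small /cell; case: ifP; lia.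
apply: run_print; [by [] | nrm; fit | nrm].
apply: run_print; [by [] | nrm; fit | nrm].
arith run_add; arith run_sub; stop; split; first last.
- nrm; lia.
- bl.
do 5!eexists; congr State; first by consl.
by rewrite row_outS -!cats1 -!catA.
Qed.

Definition row_inv t st := exists x7 x8 x9 x10 x11 x12 x13 x14,
  st = State [:: 1; n%:Z; m%:Z; nreg%:Z; (nreg + n)%N%:Z; (nreg + n + m)%N%:Z;
    t%:Z; x7; x8; x9; x10; x11; x12; x13; x14] mm [::] (all_out t).

Lemma run_row_loop s : row_inv 0 s ->
  run L row_loop (n * (n * 19 + m * (m * 12 + 22) + 14)) s (row_inv n).
Proof.
rewrite addnS; apply: run_rep => // t _ ltn
  [x7 [x8 [x9 [x10 [x11 [x12 [x13 [x14 ->]]]]]]]].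
have h1 : small (src_lo t) := HA _ (leqnn n); have h2 : small (mem_a t) := Hm _.
have h4 : small (mem_p t) := Hm _; have h5 : small (mem_q t) := Hm _.
have e1 : mm (n + m + 2 * t) = mem_p t by [].
have e2 : mm (n + m + 2 * t + 1) = mem_q t by [].
have e3 : mm t = mem_a t by [].
apply: (run_weaken
  (k := (7 + (n * 19 + (4 + (m * (m * 12 + 22) + 2))))%N) _ (fun _ h => h)).
  by lia.
apply: run_seq; arith run_add; arith run_add; fetch (n + m + 2 * t)%N.
arith run_add; fetch (n + m + 2 * t + 1)%N; const; const; stop.
rewrite e1 e2; apply: run_seq.
apply: run_weaken (leqnn _) _ (run_source_loop ltn _); last first.
  by do 4!eexists; rewrite /psum big_ord0.
move=> _ [y8 [y12 [y13 [y14 ->]]]]; rewrite -/(src_lo t).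
apply: run_seq; arith run_add; fetch t; rewrite e3; arith run_add; const; stop.
apply: run_seq.
apply: run_weaken (leqnn _) _ (run_cell_loop ltn _); last first.
  by do 5!eexists; rewrite /row_out /= cats0.
move=> _ [z10 [z11 [z12 [z13 [z14 ->]]]]].
arith run_add; arith run_sub; stop; split; first last.
- nrm; lia.
- bl.
do 8!eexists; congr State; first by consl.
exact: esym (all_outS t).
Qed.

(** X_5 counts the numbers still to be read: n supplies, m demands, 2n parts of fractions. Cells not
    yet written hold 0, the default of [nth] on the loaded prefix. *)
Definition load_inv t st := exists x3 x6,
  st = State [:: 1; n%:Z; m%:Z; x3; (nreg + t)%N%:Z; (3 * n + m)%N%:Z - t%:Z; x6;
    0; 0; 0; 0; 0; 0; 0; 0] (fun k => (take t w)`_k) (drop t w) [::].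

Lemma run_load_loop s : load_inv 0 s ->
  run L load_loop ((3 * n + m) * 5) s (load_inv (3 * n + m)).
Proof.
apply: run_rep => //; last by lia.
move=> t _ ltN [x3 [x6 ->]].
have ltw : (t < size w)%N by rewrite Hw.
have szt : size (take t w) = t by rewrite size_takel // ltnW.
have h1 := Hm t.
rewrite (drop_nth 0 ltw).
apply: run_read; [by [] | fit | nrm].
apply: (run_store (a := t)); [by [] | by nrm | nrm; fit | nrm; fit | nrm].
arith run_add; arith run_sub; stop; split; first last.
- nrm; lia.
- bl.
do 2!eexists; congr State; first by consl.
apply/funext => k; rewrite /upd (take_nth 0 ltw) nth_rcons szt.
case: eqVneq => [->|kt]; first by rewrite ltnn.
by case: ltnP => // tk; rewrite nth_default ?szt.
Qed.

Lemma run_main :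
  run L main_code
    (13 + (3 * n + m) * 5 + n * (n * 19 + m * (m * 12 + 22) + 14))
    (State (nseq nreg 0) (fun=> 0) [:: n%:Z, m%:Z & w] [::])
    (fun s => outp s = all_out n).
Proof.
apply: (run_weaken (k := (4 + (4 + ((3 * n + m) * 5 + (4 +
  n * (n * 19 + m * (m * 12 + 22) + 14)))).+1)%N) _ (fun _ h => h)); first by lia.
rewrite [nseq nreg _](_ : _ = [:: 0; 0; 0; 0; 0; 0; 0; 0; 0; 0; 0; 0; 0; 0; 0]) //.
apply: run_seq; do 2!(apply: run_read; [by [] | fit | nrm]).
const; arith run_sub; stop.
apply: run_unlesspos; [by [] | bl | nrm; lia | nrm => _].
apply: run_seq; const; arith run_add; arith run_add; arith run_add; stop.
apply: run_seq.
apply: run_weaken (leqnn _) _ (run_load_loop _); last first.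
  do 2!eexists; rewrite drop0 take0; congr State; first by consl.
  by apply/funext => k; rewrite nth_nil.
move=> _ [x3 [x6 ->]]; rewrite -Hw take_size drop_size.
apply: run_seq; const; arith run_add; arith run_add; const; stop.
apply: run_weaken (leqnn _) _ (run_row_loop _); last first.
  by do 8!eexists; congr State; consl.
by move=> _ [x7 [x8 [x9 [x10 [x11 [x12 [x13 [x14 ->]]]]]]]].
Qed.

End Program.

(** * Correctness and running time *)

(* Scaling by [n] makes the index difference a mere tie-breaker. *)
Lemma lex_test (d : int) (n i k : nat) : (i < n)%N -> (k < n)%N ->
  (0 < d * n%:Z + i%:Z - k%:Z) = (0 < d) || (d == 0) && (k < i)%N.
Proof.
move=> lin lkn; case: (ltrgt0P d) => [d0|d0|->] /=; last by rewrite mul0r; lia.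
- suff : n%:Z <= d * n%:Z by lia.
  by rewrite ler_peMl //; lia.
- suff : d * n%:Z <= - n%:Z by lia.
  by rewrite -mulN1r ler_wpM2r //; lia.
Qed.

(** [d] is [x - y] times the product of the denominators, which is positive. *)
Lemma src_test_rat (x y : rat) (d := numq x * denq y - denq x * numq y) :
  ((0 < d) = (y < x)) * ((d == 0) = (x == y)).
Proof.
have dE : d%:~R = (x - y) * (denq x * denq y)%:~R :> rat.
  rewrite /d rmorphB !rmorphM /= !numqE mulrBl; congr (_ - _).
    by rewrite !mulrA.
  by rewrite mulrCA mulrA mulrC mulrA mulrAC.
have q0 : 0 < (denq x * denq y)%:~R :> rat by rewrite ltr0z mulr_gt0.
split; first by rewrite -(ltr0z rat) dE pmulr_lgt0 // subr_gt0.
by rewrite -(intr_eq0 rat) dE mulf_eq0 (gt_eqF q0) orbF subr_eq0.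
Qed.

Lemma size_flatten_pairs (T S : Type) (g h : T -> S) s :
  size (flatten [seq [:: g x; h x] | x <- s]) = (2 * size s)%N.
Proof. by elim: s => //= x s ->; lia. Qed.

Lemma nth_flatten_pairs (T S : Type) (x0 : T) (z : S) (g h : T -> S) s i :
  (i < size s)%N ->
  (nth z (flatten [seq [:: g x; h x] | x <- s]) (2 * i) = g (nth x0 s i)) *
  (nth z (flatten [seq [:: g x; h x] | x <- s]) (2 * i + 1) = h (nth x0 s i)).
Proof.
elim: s i => [|x s IH] [|i] // lti.
have [<- <-] : _ * _ := IH i lti.
by rewrite (_ : 2 * i.+1 = (2 * i).+2)%N; last by lia.
Qed.

Lemma leq_size_word w : (size w <= word_size w)%N.
Proof.
rewrite /word_size -sum1_size; apply: leq_sum => z _; exact: ltn0Sn.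
Qed.

(** A number is below 2 to its own bit length, which is one summand of the word size. *)
Lemma word_bound w k : (`|(w`_k)%R| < 2 ^ word_size w)%N.
Proof.
have [lt|le] := ltnP k (size w); last by rewrite nth_default // expn_gt0.
apply: leq_trans (trunc_log_ltn `|(w`_k)%R|%N (isT : (1 < 2)%N)) _.
rewrite leq_exp2l // -/(bitlen _) /word_size (big_nth 0) big_mkord.
by rewrite (bigD1 (Ordinal lt)) //= leq_addr.
Qed.

Lemma psum_bound P (g : nat -> int) t X :
  (forall k, (`|g k| <= X)%N) -> (`|psum P g t| <= t * X)%N.
Proof.
move=> gX; elim: t => [|t IH]; first by rewrite /psum big_ord0.
rewrite psumS; have := gX t; case: (P t); lia.
Qed.

Lemma size_map_enum_ord (T : Type) n (g : 'I_n -> T) : size (map g (enum 'I_n)) = n.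
Proof. by rewrite size_map size_enum_ord. Qed.

(** * The encoded instance in memory *)

Section Correctness.
Variables (R : realType) (I : FCT R) (f : 'I_(nsrc I) -> rat).
Local Notation n := (nsrc I).
Local Notation m := (nsnk I).
Local Notation a := (@supply R I).
Local Notation b := (@demand R I).

Definition body : seq int :=
  [seq (a i)%:Z | i <- enum 'I_n] ++ [seq (b j)%:Z | j <- enum 'I_m]
    ++ flatten [seq encode_rat (f i) | i <- enum 'I_n].

Lemma encode_instanceE : encode_instance I f = [:: n%:Z, m%:Z & body].
Proof. by []. Qed.

Lemma size_body : size body = (3 * n + m)%N.
Proof.
by rewrite !size_cat !size_map_enum_ord size_flatten_pairs size_enum_ord; lia.
Qed.

Lemma mem_aE (i : 'I_n) : mem_a body i = a i.
Proof.
rewrite /mem_a nth_cat size_map_enum_ord ltn_ord (nth_map i) ?size_enum_ord //.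
by rewrite nth_ord_enum.
Qed.

Lemma mem_bE (j : 'I_m) : mem_b n body j = b j.
Proof.
rewrite /mem_b !nth_cat !size_map_enum_ord ltnNge leq_addr /= addKn ltn_ord.
by rewrite (nth_map j) ?size_enum_ord // nth_ord_enum.
Qed.

Lemma nth_body_tail k :
  body`_(n + m + k) = (flatten [seq encode_rat (f i) | i <- enum 'I_n])`_k.
Proof.
by rewrite /body catA nth_cat size_cat !size_map_enum_ord ltnNge leq_addr addKn.
Qed.

Lemma mem_pE (i : 'I_n) : mem_p n m body i = numq (f i).
Proof.
rewrite /mem_p nth_body_tail (nth_flatten_pairs i) ?size_enum_ord //.
by rewrite nth_ord_enum.
Qed.

Lemma mem_qE (i : 'I_n) : mem_q n m body i = denq (f i).
Proof.
rewrite /mem_q -addnA nth_body_tail (nth_flatten_pairs i) ?size_enum_ord //.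
by rewrite nth_ord_enum.
Qed.

Lemma src_beforeE (i k : 'I_n) : src_before n m body i k = precedes f k i.
Proof.
rewrite /src_before /src_cmp lex_test // !mem_pE !mem_qE.
by rewrite !src_test_rat.
Qed.

Lemma snk_beforeE (j k : 'I_m) : snk_before n m body j k = precedes b k j.
Proof.
rewrite /snk_before /snk_cmp lex_test // !mem_bE /precedes subr_gt0 subr_eq0.
by rewrite ltz_nat eqz_nat.
Qed.

Lemma src_loE (i : 'I_n) : src_lo n m body i = lo f a i.
Proof.
rewrite /src_lo /psum /lo (big_morph Posz PoszD (erefl (Posz 0))) [RHS]big_mkcond /=.
by apply: eq_bigr => k _; rewrite src_beforeE mem_aE.
Qed.

Lemma snk_loE (j : 'I_m) : snk_lo n m body j = lo b b j.
Proof.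
rewrite /snk_lo /psum /lo (big_morph Posz PoszD (erefl (Posz 0))) [RHS]big_mkcond /=.
by apply: eq_bigr => k _; rewrite snk_beforeE mem_bE.
Qed.

(** The truncated subtraction in [overlap] does what the explicit clipping does over the
    integers. *)
Lemma cellE (i : 'I_n) (j : 'I_m) : cell n m body i j = overlap f a b b i j.
Proof.
rewrite /cell src_loE snk_loE mem_aE mem_bE /overlap /hi.
by case: ifP; lia.
Qed.

Lemma all_outE : all_out n m body n = encode_solution (solution f).
Proof.
rewrite /all_out /encode_solution -val_enum_ord -map_comp; congr flatten.
apply: eq_map => i /=; rewrite /row_out -val_enum_ord -map_comp; congr flatten.
apply: eq_map => j /=; rewrite cellE mxE /encode_rat.
by rewrite pmulrn numq_int denq_int.
Qed.

End Correctness.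

Lemma run_main_empty E :
  run (2 * E.+1) main_code 5 (State (nseq nreg 0) (fun=> 0) [:: 0; 0] [::])
    (fun s => outp s = [::]).
Proof.
have fits0 : fits E 0 by [].
have fits1 : fits E 1 by rewrite /fits /= expn_gt0.
apply: (@run_seq _ _ _ 4 1).
apply: run_read => //; apply: run_read => //; apply: run_const => //.
by apply: run_sub => //; apply: run_nil; apply: run_unlesspos.
Qed.

Lemma init_conf w : init w = conf 0 (State (nseq nreg 0) (fun=> 0) w [::]).
Proof.
by congr Config; apply/funext => k; rewrite /regfile nth_nseq !if_same.
Qed.

(** All lower powers are raised to the cube: 34 = 12 + 22, 67 = 19 + 34 + 14 and 85 = 13 + 5 +
    67. *)
Lemma step_bound n m W : (3 * n + m < W)%N ->
  (13 + (3 * n + m) * 5 + n * (n * 19 + m * (m * 12 + 22) + 14) <= 85 * W ^ 3)%N.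
Proof.
move=> ltW; have w1 : (W <= W * W)%N by nia.
have w2 : (W * W <= W * (W * W))%N by nia.
have i1 : (m * (m * 12 + 22) <= W * (W * 34))%N by apply: leq_mul; lia.
have i2 : (n * (n * 19 + m * (m * 12 + 22) + 14) <= W * (W * W * 67))%N.
  by apply: leq_mul; lia.
by rewrite !expnS expn0 muln1; lia.
Qed.

Lemma horner_nat_monomial (c k x : nat) : (c%:P * 'X^k).[x] = (c * x ^ k)%N.
Proof. by rewrite hornerCM hornerXn. Qed.

Lemma time_bound W : (0 < W)%N ->
  (85 * W ^ 3 * (2 * (8 * W).+1) <= 85 * 18 * W ^ 4)%N.
Proof.
by move=> W0; rewrite [(W ^ 4)%N]expnSr [leqRHS]mulnACA; apply: leq_mul => //; lia.
Qed.

Theorem theorem1p1 :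
  exists (P : program) (p : {poly nat}),
    forall (R : realType) (I : FCT R) (f : 'I_(nsrc I) -> rat),
      PFCTS I (fun i => ratr (f i)) ->
      exists (x : 'M[rat]_(nsrc I, nsnk I)) (t : nat),
        [/\ computes_in P (encode_instance I f) t (encode_solution x),
            (t <= p.[word_size (encode_instance I f)])%N,
            feasible I (map_mx ratr x)
          & cost I (map_mx ratr x) <= 2 * opt I].
Proof.
(* At most [85 * W ^ 3] instructions, each of cost at most [2 * (8 * W).+1], which is at most
   [18 * W]. *)
exists (main_code 0), ((85 * 18)%N%:P * 'X^4) => R I f HI.
set W := word_size _.
have lW : (3 * nsrc I + nsnk I + 2 <= W)%N.
  rewrite (leq_trans _ (leq_size_word _)) // encode_instanceE /= size_body; lia.
have [t [s [ht tk ho]]] : exists t s,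
    [/\ halts_in (main_code 0) (init (encode_instance I f)) t
          (conf (size (main_code 0)) s),
        (t <= 85 * W ^ 3 * (2 * (8 * W).+1))%N
      & outp s = encode_solution (solution f)].
  rewrite init_conf encode_instanceE -all_outE; apply: run_halts.
  have [n0|n_gt0] := posnP (nsrc I).
    (* Without sources the total demand is 0, and demands are positive. *)
    have m0 : nsnk I = 0%N.
      have := balanced I; rewrite big1 => [/esym/eqP|i _].
        rewrite sum_nat_eq0 => /forallP b0; case: (posnP (nsnk I)) => // mgt0.
        by have := b0 (Ordinal mgt0); have := demand_gt0 (Ordinal mgt0); case: demand.
      by have := ltn_ord i; rewrite [X in (_ < X)%N]n0.
    have -> : body f = [::] by apply/size0nil; rewrite size_body n0 m0.
    rewrite n0 m0 {1}/all_out /=; apply: run_weaken _ _ (run_main_empty _) => //.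
    by rewrite (leq_trans (_ : 5 <= 85 * 1)%N) // leq_mul2l expn_gt0; lia.
  have m_gt0 : (0 < nsnk I)%N.
    rewrite lt0n; apply/eqP => m0; have := balanced I.
    rewrite [RHS]big1 => [|j _]; last by have := ltn_ord j; rewrite [X in (_ < X)%N]m0.
    move/eqP; rewrite sum_nat_eq0 => /forallP a0.
    by have := a0 (Ordinal n_gt0); have := supply_gt0 (Ordinal n_gt0); case: supply.
  (* [X] bounds every input number as well as n and m, and the values to be bounded are at most
     [X ^ 4]. As [X >= 4], even [8 * X ^ 6 <= X ^ 8], whence the choice [E = 8 * W]. *)
  pose X := (2 ^ W)%N.
  have X4 : (4 <= X)%N by rewrite -[4%N]/(2 ^ 2)%N leq_exp2l //; lia.
  have XW : (W < X)%N by apply: ltn_expl.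
  have XE : (2 ^ (8 * W) = X ^ 8)%N by rewrite mulnC expnM.
  have bX k : (`|((body f)`_k)%R| <= X)%N.
    (* The shift by 2 skips the two counts at the head of the word. *)
    by have := word_bound (encode_instance I f) k.+2; rewrite -/W -/X => /ltnW.
  have XX j k : (k <= X ^ j)%N -> (j <= 6)%N -> (8 * k <= X ^ 8)%N.
    move=> kj j6; apply: (@leq_trans (X ^ 2 * X ^ 6)%N); last by rewrite -expnD.
    apply: leq_mul; first by rewrite -mulnn (leq_trans _ (leq_mul X4 X4)).
    by apply: leq_trans kj _; rewrite leq_exp2l //; lia.
  have nX : (nsrc I <= X)%N by lia.
  have mX : (nsnk I <= X)%N by lia.
  apply: run_weaken _ _ (@run_main _ _ (body f) (8 * W) (X ^ 8)%N _ _ _ _ _ _ _ _ _ _ _) => //.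
  - by apply: step_bound; lia.
  - by rewrite size_body.
  - apply: (@XX 4) => //; rewrite /nreg.
    by rewrite (leq_trans (_ : _ <= X * X * X)%N) //; nia.
  - by move=> k; apply: (@XX 1).
  - move=> i k _ _; apply: (@XX 2) => //.
    by rewrite abszM -mulnn leq_mul //; apply: bX.
  - move=> i k _ _; apply: (@XX 4) => //; rewrite /src_cmp abszM.
    have h u v : (`|((body f)`_u * (body f)`_v)%R| <= X ^ 2)%N.
      by rewrite abszM -mulnn leq_mul.
    apply: (@leq_trans (X ^ 3 * X)%N); last by rewrite -expnSr.
    apply: leq_mul => //; apply: (@leq_trans (2 * X ^ 2)%N); last first.
      by rewrite [leqRHS]expnS leq_mul2r; lia.
    have := h (nsrc I + nsnk I + 2 * k)%N (nsrc I + nsnk I + 2 * i + 1)%N.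
    have := h (nsrc I + nsnk I + 2 * k + 1)%N (nsrc I + nsnk I + 2 * i)%N.
    by rewrite /mem_p /mem_q; move: (_ * _) (_ * _) => u v; lia.
  - move=> j k _ _; apply: (@XX 3) => //; rewrite /snk_cmp abszM.
    apply: (@leq_trans (X ^ 2 * X)%N); last by rewrite -expnSr.
    apply: leq_mul => //; have := bX (nsrc I + k)%N; have := bX (nsrc I + j)%N.
    rewrite /mem_b -mulnn; nia.
  - move=> P t tn; apply: (@XX 2) => //; apply: leq_trans (psum_bound _ _ bX) _.
    by rewrite -mulnn leq_mul // (leq_trans tn).
  - move=> P t tm; apply: (@XX 2) => //.
    apply: leq_trans (psum_bound _ _ (fun k => bX (nsrc I + k)%N)) _.
    by rewrite -mulnn leq_mul // (leq_trans tm).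
exists (solution f), t; split.
- by exists (conf (size (main_code 0)) s).
- rewrite horner_nat_monomial; apply: leq_trans tk _; apply: time_bound; lia.
- exact: solution_feasible.
- exact: solution_cost.
Qed.
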